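(* Let $\mathscr{P}=(A,B,C)$ be a linear time-invariant system with $A\in\mathbb{R}^{n\times n}$, $B\in\mathbb{R}^{n\times m}$, $C\in\mathbb{R}^{q\times n}$. Then $\mathscr{P}^N$ is output-feedback synchronizable for all integers $N>1$ if and only if $\mathscr{P}$ is output-feedback stabilizable.
   Context: Graphs: $\mathcal{G}^N$ is the set of directed weighted graphs on nodes $\{1,\dots,N\}$ given by a weighted adjacency matrix $\Sigma=(\sigma_{i,j})\in\mathbb{R}^{N\times N}$ with $\sigma_{i,i}=0$ for all $i$ ($(i,j)$ is an edge iff $\sigma_{i,j}\neq0$). Weights may be negative and $\Sigma$ need not be symmetric. Network: for $K\in\mathbb{R}^{m\times q}$ and $\mathscr{G}\in\mathcal{G}^N$, the network $(\mathscr{P}^N,K,\mathscr{G})$ consists of $N$ copies of the system, $\dot x_i=Ax_i+Bu_i$, $y_i=Cx_i$, $x_i\in\mathbb{R}^n$, $u_i\in\mathbb{R}^m$, $y_i\in\mathbb{R}^q$, $i=1,\dots,N$, coupled by $u_i=K\sum_{j=1}^N\sigma_{i,j}(y_j-y_i)$. It is said to synchronize if $\lim_{t\to\infty}(x_i(t)-x_j(t))=0$ for all $i,j$ and all initial conditions. Throughout, $N>1$. The collection $\mathscr{P}^N$ ($N$ copies of $\mathscr{P}$) is output-feedback synchronizable (OFS) if there exist $K\in\mathbb{R}^{m\times q}$ and $\mathscr{G}\in\mathcal{G}^N$ such that $(\mathscr{P}^N,K,\mathscr{G})$ synchronizes. The system $\mathscr{P}$ is output-feedback stabilizable if there exists $K\in\mathbb{R}^{m\times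 q}$ such that $A-BKC$ is Hurwitz (all eigenvalues have strictly negative real part). *)

(* Defs.v *)
From HB Require Import structures.
From mathcomp Require Import all_boot all_order all_algebra.
From mathcomp Require Import all_classical all_reals all_analysis.
From mathcomp Require Import complex.

Set Implicit Arguments.
Unset Strict Implicit.
Unset Printing Implicit Defensive.

Import Order.TTheory GRing.Theory Num.Theory.
Import numFieldNormedType.Exports.

Local Open Scope classical_set_scope.
Local Open Scope ring_scope.

Record lti_system (R : realType) (n m q : nat) := LTI {
  stateM : 'M[R]_n;
  inputM : 'M[R]_(n, m);
  outputM : 'M[R]_(q, n)
}.

(* The weights are arbitrary reals: they may be negative, and [weight] need not
   be symmetric. *)
Record wdigraph (R : realType) (N : nat) := WDigraph {
  weight : 'M[R]_N;
  weight_diag : forall i : 'I_N, weight i i = 0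
}.

(* [eigenvalue] is about left (row) eigenvectors; over a field the left and
   right spectra coincide. *)
Definition hurwitz (R : realType) (n : nat) (M : 'M[R]_n) : Prop :=
  forall z : R[i], eigenvalue (map_mx (real_complex R) M) z -> complex.Re z < 0.

Definition of_stabilizable (R : realType) (n m q : nat)
    (P : lti_system R n m q) : Prop :=
  exists K : 'M[R]_(m, q),
    hurwitz (stateM P - inputM P *m K *m outputM P).

Section Network.
Variables (R : realType) (n m q N : nat).
Variables (P : lti_system R n m q) (K : 'M[R]_(m, q)) (G : wdigraph R N).

Definition net_output (x : 'I_N -> 'cV[R]_n) (i : 'I_N) : 'cV[R]_q :=
  outputM P *m x i.

Definition net_input (x : 'I_N -> 'cV[R]_n) (i : 'I_N) : 'cV[R]_m :=
  K *m \sum_(j < N) weight G i j *: (net_output x j - net_output x i).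

(* Forward-time solution on [0, +oo[ of the initial value problem: the values
   of [x] at negative times are irrelevant, so at time 0 only continuity from
   the right is required. *)
Definition net_solution (x0 : 'I_N -> 'cV[R]_n)
    (x : 'I_N -> R -> 'cV[R]_n) : Prop :=
  forall i : 'I_N,
    [/\ x i 0 = x0 i,
        x i t @[t --> 0^'+] --> x0 i
      & forall t : R, 0 < t ->
          is_derive t 1 (x i)
            (stateM P *m x i t + inputM P *m net_input (x ^~ t) i)].

(* The network is linear, so each initial condition has exactly one solution
   on [0, +oo[;
   quantifying over all solutions is quantifying over initial conditions. *)
Definition synchronizes : Prop :=
  forall (x0 : 'I_N -> 'cV[R]_n) (x : 'I_N -> R -> 'cV[R]_n),
    net_solution x0 x ->
    forall i j : 'I_N, (x i t - x j t) @[t --> +oo] --> (0 : 'cV[R]_n).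

End Network.

Definition of_synchronizable (R : realType) (n m q : nat)
    (P : lti_system R n m q) (N : nat) : Prop :=
  exists (K : 'M[R]_(m, q)) (G : wdigraph R N), synchronizes P K G.

(* Main.v *)
Require Import Defs.
From mathcomp Require Import all_boot all_order all_algebra.
From mathcomp Require Import all_classical all_reals all_analysis.
From mathcomp Require Import complex ring lra.

Set Implicit Arguments.
Unset Strict Implicit.
Unset Printing Implicit Defensive.

Import Order.TTheory GRing.Theory Num.Theory.
Import numFieldNormedType.Exports.

Local Open Scope classical_set_scope.
Local Open Scope ring_scope.

(** Write [M_k = A - k B K C].  Both directions come down to one fact about
a difference [e = x_i - x_j] of two agents: for well chosen networks it obeys
the autonomous equation [e' = M_k e], so that synchronization is the stability
of that equation.

If [A - B K C] is Hurwitz, give all edges of the complete graph the weight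
[1/N].  Each agent is then pulled towards the average of all agents, the average
cancels in a difference, and every [x_i - x_j] obeys [e' = M_1 e]
([uniform_graph_field]).  Conversely, synchronizability is only used for two
agents: whatever the weights [a] and [b] of the two edges, [x_1 - x_2] obeys
[e' = M_k e] with [k = a + b] ([pair_field]), so [k K] is the stabilizing gain.

It remains to see that [M] is Hurwitz exactly when the solutions of [e' = M e]
tend to 0.  Instead of a Jordan form, the proof looks at [e] through complex row
vectors [psi].  If [psi M = z psi + phi], the scalar function [psi e] obeys
[(psi e)' = z (psi e) + phi e], a planar real system once split into real and
imaginary parts.  When [Re z < 0] and [phi e] tends to 0, so does [psi e]
([planar_decay]).  By Cayley-Hamilton, [psi] times the product of the factors
[M - z], for [z] running through the roots of the characteristic polynomial, is
zero for every [psi]; peeling off the factors one at a time shows that [psi e]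
tends to 0 for every [psi] ([hurwitz_decay]).  When [psi] is a left eigenvector
for [z] with [Re z >= 0], [phi] is 0 and [|psi e|^2] never decreases
([planar_persistence]), so it can only tend to 0 if [psi e(0) = 0]; since [e(0)]
is arbitrary this forces [psi = 0] ([decay_hurwitz]).

The last argument needs a network solution for every initial condition, and the
definition of synchronization quantifies over solutions without providing any.
They are given by the exponential series of the linear vector field of the
network ([linear_flow], [net_solution_exists]).  Solving for the whole network,
instead of lifting a prescribed [e] to a pair [(x_1, x_2)], treats all weights
alike: when [a + b = 0] the Laplacian need not be diagonalizable, and such a lift
has to solve a forced equation. *)

(** * Limits and derivatives of matrix-valued functions *)

Lemma cvg_mxP (R : realType) (m n : nat) (T : Type) (F : set_system T)
    (X : T -> 'M[R]_(m, n)) (L : 'M[R]_(m, n)) : Filter F ->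
  X @ F --> L <-> forall i j, X x i j @[x --> F] --> L i j.
Proof.
move=> FF; split=> [XL i j | XL].
  exact: (cvg_comp _ _ XL (@coord_continuous _ _ _ i j L)).
apply/cvgrPdist_le => /= e e0; near=> x.
rewrite [leLHS]/Num.Def.normr/= mx_normrE (bigmax_le _ (ltW e0))//= => i _.
rewrite !mxE/=.
move: i; near: x; apply: filter_forall => /= i.
exact: ((cvgrPdist_le _ _).1 (XL i.1 i.2)).
Unshelve. all: by end_near. Qed.

Lemma is_derive_mxP (R : realType) (m n : nat)
    (X : R -> 'M[R]_(m, n)) (D : 'M[R]_(m, n)) (t : R) :
  is_derive t 1 X D <-> forall i j, is_derive t 1 (fun s => X s i j) (D i j).
Proof.
split=> [dX i j | dX].
  have dXt : derivable X t 1 by [].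
  apply: DeriveDef; first exact: (derivable_mxP _ _ _).1.
  by rewrite -[D]derive_val derive_mx // mxE.
have dXt : derivable X t 1 by apply/derivable_mxP => i j; case: (dX i j).
apply: DeriveDef => //.
by rewrite derive_mx //; apply/matrixP => i j; rewrite mxE derive_val.
Qed.

Lemma cvg_mulmx (R : realType) (m n p : nat) (T : Type) (F : set_system T)
    (U : 'M[R]_(m, n)) (X : T -> 'M[R]_(n, p)) (L : 'M[R]_(n, p)) : Filter F ->
  X @ F --> L -> (U *m X x) @[x --> F] --> U *m L.
Proof.
move=> FF /cvg_mxP XL; apply/cvg_mxP => i j.
under eq_fun do rewrite mxE; rewrite mxE.
by apply: cvg_big => [|k _]; [exact: add_continuous | apply: cvgMl_tmp; exact: XL].
Qed.

Lemma is_derive_mulmx (R : realType) (m n p : nat) (U : 'M[R]_(m, n))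
    (X : R -> 'M[R]_(n, p)) (D : 'M[R]_(n, p)) (t : R) :
  is_derive t 1 X D -> is_derive t 1 (fun s => U *m X s) (U *m D).
Proof.
move=> /is_derive_mxP dX; apply/is_derive_mxP => i j.
rewrite mxE.
rewrite [X in is_derive _ _ X _](_ : _ =
  \sum_(k < n) (fun s => U i k * X s k j)); last first.
  by apply/funext => s; rewrite mxE fct_sumE.
apply: is_derive_sum.
Qed.

(** * Scalar and planar linear differential equations *)

(** Once [h <= c e / 2], the function [exp (c t) (w t - e / 2)] is nonincreasing,
so that [w - e / 2] is bounded by a multiple of [exp (- c t)]. *)
Lemma ode_forced_decay (R : realType) (c : R) (w dw h : R -> R) :
  0 < c ->
  (forall t : R, 0 < t -> is_derive t 1 w (dw t)) ->
  (forall t : R, 0 < t -> dw t <= - c * w t + h t) ->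
  (forall t : R, 0 <= w t) ->
  h t @[t --> +oo] --> 0 -> w t @[t --> +oo] --> 0.
Proof.
move=> c0 dwE dwle w0 h0; apply/cvgrPdist_le => e e0.
have : \forall t \near +oo, 0 < t /\ h t <= c * (e / 2).
  near=> t; split; first by near: t; exact: nbhs_pinfty_gt.
  rewrite (le_trans (ler_norm _))//.
  have -> : `|h t| = `|0 - h t| by rewrite sub0r normrN.
  by near: t; apply: (cvgrPdist_le _ _).1 h0 _ _; rewrite mulr_gt0 ?divr_gt0.
move=> [T [_ HT]].
pose T1 := Num.max T 0 + 1.
have T1T (s : R) : T1 <= s -> 0 < s /\ h s <= c * (e / 2).
  move=> T1s; apply: HT; apply: lt_le_trans T1s.
  by rewrite ltr_pwDr// le_max lexx.
pose v (s : R) : R := expR (c * s) * (w s - e / 2).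
have dv (s : R) : 0 < s ->
    is_derive s 1 v (expR (c * s) * (c * (w s - e / 2) + dw s)).
  move=> s0; have dws := dwE s s0.
  apply: is_derive_eq.
  by rewrite /GRing.scale /= !mulr1 !subr0; ring.
have v_le (x y : R) : T1 <= x -> x <= y -> v y <= v x.
  apply: ler0_derive1_nincry => [s|s|].
  - rewrite in_itv/= andbT => /ltW /T1T[s0 _].
    by have [] := dv s s0.
  - rewrite in_itv/= andbT => /ltW /T1T[s0 hs].
    rewrite derive1E; have /= := dv s s0 => ?; rewrite derive_val.
    rewrite pmulr_rle0 ?expR_gt0//.
    have := dwle s s0; lra.
  apply: derivable_within_continuous => s.
  rewrite in_itv/= andbT => /T1T[s0 _].
  by have [] := dv s s0.
have gap : expR (- (c * t)) * v T1 @[t --> +oo] --> 0.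
  rewrite -[X in _ --> X](mul0r (v T1)); apply: cvgMr_tmp.
  apply: (@cvg_comp _ _ _ (fun t : R => c * t) (fun t : R => expR (- t)) +oo (+oo : set_system R)).
    exact: (@gt0_cvgMry _ _ _ _ id c0 cvg_id).
  exact: cvgr_expR.
near=> t; rewrite sub0r normrN ger0_norm//.
have t1 : T1 <= t by near: t; apply: nbhs_pinfty_ge; rewrite num_real.
have := v_le _ _ (lexx _) t1; rewrite {1}/v => vt.
have ge : expR (- (c * t)) * v T1 <= e / 2.
  rewrite (le_trans (ler_norm _))// -normrN -sub0r.
  by near: t; apply: (cvgrPdist_le _ _).1 gap _ _; rewrite divr_gt0.
have : w t - e / 2 <= expR (- (c * t)) * v T1.
  by rewrite expRN [leRHS]mulrC ler_pdivlMr ?expR_gt0// mulrC.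
lra.
Unshelve. all: by end_near. Qed.

Lemma is_derive_sqrD (R : realType) (p s : R -> R) (dp ds t : R) :
  is_derive t 1 p dp -> is_derive t 1 s ds ->
  is_derive t 1 (fun u => p u ^+ 2 + s u ^+ 2) (2 * (p t * dp + s t * ds)).
Proof.
move=> dpt dst; apply: is_derive_eq.
by rewrite /GRing.scale /=; ring.
Qed.

(** With [z = a + i b] and [y = p + i s] this is [y' = z y + (f + i g)].  The
rotation [i b] does not act on [|y|^2], and half of the damping [2 a |y|^2]
absorbs the cross terms [2 (p f + s g)], which leaves
[(|y|^2)' <= a |y|^2 - (f^2 + g^2) / a]. *)
Lemma planar_decay (R : realType) (a b : R) (p s f g : R -> R) :
  a < 0 ->
  (forall t : R, 0 < t -> is_derive t 1 p (a * p t - b * s t + f t)) ->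
  (forall t : R, 0 < t -> is_derive t 1 s (b * p t + a * s t + g t)) ->
  f t @[t --> +oo] --> 0 -> g t @[t --> +oo] --> 0 ->
  p t @[t --> +oo] --> 0 /\ s t @[t --> +oo] --> 0.
Proof.
move=> a0 dp ds f0 g0.
have w0 : (p t ^+ 2 + s t ^+ 2) @[t --> +oo] --> 0.
  apply: (@ode_forced_decay _ (- a) _
    (fun t => 2 * (p t * (a * p t - b * s t + f t)
                   + s t * (b * p t + a * s t + g t)))
    (fun t => (- a)^-1 * (f t ^+ 2 + g t ^+ 2))).
  - by rewrite oppr_gt0.
  - by move=> t t0; apply: is_derive_sqrD; [exact: dp | exact: ds].
  - move=> t t0; rewrite -subr_ge0.
    (* What half of the damping leaves is a sum of squares. *)
    have -> : - - a * (p t ^+ 2 + s t ^+ 2)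
        + (- a)^-1 * (f t ^+ 2 + g t ^+ 2)
        - 2 * (p t * (a * p t - b * s t + f t) + s t * (b * p t + a * s t + g t))
      = (- a)^-1 * ((a * p t + f t) ^+ 2 + (a * s t + g t) ^+ 2).
      by field; rewrite ?oppr_eq0 lt_eqF.
    by rewrite mulr_ge0 ?invr_ge0 ?oppr_ge0 ?(ltW a0)// addr_ge0 ?sqr_ge0.
  - by move=> t; rewrite addr_ge0 ?sqr_ge0.
  - have -> : 0 = (- a)^-1 * (0 * 0 + 0 * 0) :> R by rewrite !mul0r addr0 mulr0.
    by apply: cvgMl_tmp; apply: cvgD; apply: cvgM.
have half (u v : R -> R) : (u t ^+ 2 + v t ^+ 2) @[t --> +oo] --> 0 ->
    u t @[t --> +oo] --> 0.
  move=> uv0; apply/cvgrPdist_le => e e0; near=> t.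
  rewrite sub0r normrN -(@ler_pXn2r _ 2)// ?nnegrE ?(ltW e0)// -normrX.
  rewrite ger0_norm ?sqr_ge0//.
  have : `|0 - (u t ^+ 2 + v t ^+ 2)| <= e ^+ 2.
    by near: t; apply: (cvgrPdist_le _ _).1 uv0 _ _; rewrite exprn_gt0.
  rewrite sub0r normrN ger0_norm ?addr_ge0 ?sqr_ge0//.
  by apply: le_trans; rewrite lerDl sqr_ge0.
split; first exact: half w0.
by apply: (half s p); under eq_fun do rewrite addrC.
Unshelve. all: by end_near. Qed.

(** Without forcing and with [0 <= a], the function [p^2 + s^2] is nondecreasing;
being at least 0 and tending to 0 at infinity, it vanishes, and so does its limit
at 0.  Only limits at 0 are assumed, because the differential equation holds on
the open half-line. *)
Lemma planar_persistence (R : realType) (a b p0 s0 : R) (p s : R -> R) :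
  0 <= a ->
  (forall t : R, 0 < t -> is_derive t 1 p (a * p t - b * s t)) ->
  (forall t : R, 0 < t -> is_derive t 1 s (b * p t + a * s t)) ->
  p t @[t --> 0^'+] --> p0 -> s t @[t --> 0^'+] --> s0 ->
  p t @[t --> +oo] --> 0 -> s t @[t --> +oo] --> 0 ->
  p0 = 0 /\ s0 = 0.
Proof.
move=> a0 dp ds pp0 ss0 poo soo.
pose w (t : R) := p t ^+ 2 + s t ^+ 2.
have dw (t : R) : 0 < t -> is_derive t 1 w (2 * a * w t).
  move=> t0; rewrite (_ : 2 * a * w t =
    2 * (p t * (a * p t - b * s t) + s t * (b * p t + a * s t))).
    exact: is_derive_sqrD (dp t t0) (ds t t0).
  by rewrite /w; ring.
have w_le (x y : R) : 0 < x -> x <= y -> w x <= w y.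
  move=> x0; apply: (@ger0_derive1_ndecry _ w x) => [r|r| | //].
  - by rewrite in_itv/= andbT => xr; case: (dw r (lt_trans x0 xr)).
  - rewrite in_itv/= andbT => xr; rewrite derive1E.
    have := dw r (lt_trans x0 xr) => dwr; rewrite derive_val.
    by rewrite mulr_ge0 ?mulr_ge0// addr_ge0 ?sqr_ge0.
  - apply: derivable_within_continuous => r.
    by rewrite in_itv/= andbT => xr; case: (dw r (lt_le_trans x0 xr)).
have woo : w t @[t --> +oo] --> 0.
  have -> : 0 = 0 * 0 + 0 * 0 :> R by rewrite !mul0r addr0.
  by apply: cvgD; apply: cvgM.
have w_le0 (x : R) : 0 < x -> w x <= 0.
  move=> x0; apply: (cvgr_to_ge woo).
  by near=> t; apply: w_le.
have w00 : w t @[t --> 0^'+] --> p0 * p0 + s0 * s0.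
  by apply: cvgD; apply: cvgM.
have : p0 * p0 + s0 * s0 <= 0.
  apply: (cvgr_to_le w00).
  by near=> t; apply: w_le0; near: t; exact: nbhs_right_gt.
rewrite -!expr2 => le0.
have /eqP : p0 ^+ 2 + s0 ^+ 2 = 0.
  by apply/eqP; rewrite eq_le le0 addr_ge0 ?sqr_ge0.
by rewrite paddr_eq0 ?sqr_ge0// !sqrf_eq0 => /andP[/eqP -> /eqP ->].
Unshelve. all: by end_near. Qed.

(** * The flow of a linear vector field on matrices *)

Lemma mx_entry_le_norm (R : realType) (m n : nat) (Y : 'M[R]_(m, n)) i j :
  `|Y i j| <= `|Y|.
Proof.
rewrite [leRHS]/Num.Def.normr/= mx_normrE.
exact: (le_bigmax _ (fun ij => `|Y ij.1 ij.2|) (i, j)).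
Qed.

Lemma linear_mx_bounded (R : realType) (m n : nat)
    (T : {linear 'M[R]_(m, n) -> 'M[R]_(m, n)}) :
  exists2 c : R, 0 <= c & forall Y, `|T Y| <= c * `|Y|.
Proof.
exists (\sum_i \sum_j `|T (delta_mx i j)|) => [|Y].
  by rewrite sumr_ge0 // => i _; rewrite sumr_ge0.
rewrite {1}[Y]matrix_sum_delta linear_sum (le_trans (ler_norm_sum _ _ _))//.
rewrite mulr_suml; apply: ler_sum => i _.
rewrite linear_sum (le_trans (ler_norm_sum _ _ _))//.
rewrite mulr_suml; apply: ler_sum => j _.
by rewrite linearZ /= normrZ mulrC ler_wpM2l ?mx_entry_le_norm.
Qed.

Lemma linear_mx_continuous (R : realType) (m n : nat)
    (T : {linear 'M[R]_(m, n) -> 'M[R]_(m, n)}) : continuous T.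
Proof.
apply/linear_bounded_continuous/linear_boundedP.
have [c c0 Tc] := linear_mx_bounded T.
near=> r => Y; apply: le_trans (Tc Y) _; rewrite ler_wpM2r//.
Unshelve. all: by end_near. Qed.

Section LinearFlow.
Variables (R : realType) (m n : nat) (T : {linear 'M[R]_(m, n) -> 'M[R]_(m, n)}).
Implicit Types (X : 'M[R]_(m, n)) (t : R).

Let coef X (i : 'I_m) (j : 'I_n) (k : nat) : R := k`!%:R^-1 * iter k T X i j.

(** The exponential series [exp (t T) X], summed entry by entry so that the
results on real power series apply. *)
Definition linear_flow X t : 'M[R]_(m, n) :=
  \matrix_(i, j) limn (pseries (coef X i j) t).

(** The entries of [T^k X] are at most [c^k |X|], so the exponential series of
[c |t|] dominates. *)
Let cvg_coef X i j t : cvgn (pseries (coef X i j) t).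
Proof.
have [c c0 Tc] := linear_mx_bounded T.
have iterb k : `|iter k T X| <= c ^+ k * `|X|.
  elim: k => [|k IH]; first by rewrite expr0 mul1r.
  by rewrite iterS (le_trans (Tc _))// exprS -mulrA ler_wpM2l.
apply: normed_cvg => /=.
apply: (@series_le_cvg _ _ (fun k => `|X| * exp_coeff (c * `|t|) k)) => [k|k|k|] //=.
- by rewrite mulr_ge0// exp_coeff_ge0 ?mulr_ge0.
- rewrite /coef !normrM normfV normr_nat normrX.
  rewrite [leLHS](_ : _ = (`|iter k T X i j| * `|t| ^+ k) / k`!%:R); last by ring.
  rewrite [leRHS](_ : _ = ((c ^+ k * `|X|) * `|t| ^+ k) / k`!%:R); last first.
    by rewrite /exp_coeff /= exprMn; ring.
  rewrite ler_wpM2r ?invr_ge0// ler_wpM2r ?exprn_ge0//.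
  exact: le_trans (mx_entry_le_norm _ _ _) (iterb k).
- exact: is_cvg_seriesZ (is_cvg_series_exp_coeff _).
Qed.

(** Differentiating the series term by term amounts to replacing [X] by [T X]. *)
Let coef_diffs X i j : pseries_diffs (coef X i j) = coef (T X) i j.
Proof.
apply/funext => k; rewrite /pseries_diffs /coef -iterSr mulrA; congr (_ * _).
by rewrite factS natrM invfM mulVKf// pnatr_eq0.
Qed.

(** The partial sums commute with [T] since iterates of [T] do, and the limits
follow by continuity of [T]. *)
Let linear_flow_commutes X t : linear_flow (T X) t = T (linear_flow X t).
Proof.
pose S N : 'M[R]_(m, n) := \sum_(0 <= k < N) (k`!%:R^-1 * t ^+ k) *: iter k T X.
have SE Y N i j : (\sum_(0 <= k < N) (k`!%:R^-1 * t ^+ k) *: iter k T Y) i j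
    = pseries (coef Y i j) t N.
  rewrite summxE; apply: eq_bigr => k _.
  by rewrite mxE /coef /= mulrAC.
have SX : S @ \oo --> linear_flow X t.
  apply/cvg_mxP => i j; rewrite mxE.
  under eq_fun do rewrite SE.
  exact: cvg_coef.
have TSX : T (S N) @[N --> \oo] --> T (linear_flow X t).
  exact: cvg_comp SX (@linear_mx_continuous _ _ _ T _).
apply/matrixP => i j; rewrite mxE; apply/cvg_lim => //.
apply: cvg_trans ((cvg_mxP _ _ _).1 TSX i j).
apply: near_eq_cvg; near=> N.
rewrite -SE linear_sum; congr (fun_of_matrix _ i j).
by apply: eq_bigr => k _; rewrite linearZ -iterS iterSr.
Unshelve. all: by end_near. Qed.

Lemma linear_flow0 X : linear_flow X 0 = X.
Proof.
apply/matrixP => i j; rewrite mxE; apply: lim_near_cst => //.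
near=> N.
have N0 : (0 < N)%N by near: N; exact: nbhs_infty_gt.
rewrite -(prednK N0) /pseries /series /= big_nat_recl//= big1 => [|k _].
  by rewrite addr0 /coef /= fact0 invr1 mul1r expr0 mulr1.
by rewrite expr0n mulr0.
Unshelve. all: by end_near. Qed.

Lemma is_derive_linear_flow X t :
  is_derive t 1 (linear_flow X) (T (linear_flow X t)).
Proof.
rewrite -linear_flow_commutes; apply/is_derive_mxP => i j.
rewrite mxE; under eq_fun do rewrite mxE.
rewrite -coef_diffs.
apply: (@pseries_snd_diffs _ _ (`|t| + 1)); rewrite ?coef_diffs ?coef_diffs//.
by rewrite [ltRHS]ger0_norm ?addr_ge0// ltrDl.
Qed.

End LinearFlow.

(** * Stability of a linear system and the spectrum of its matrix *)

Section LinearFunctionals.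
Variables (R : realType) (n : nat).
Implicit Types (psi phi : 'rV[R[i]]_n) (v : 'cV[R]_n).

(** The real and imaginary parts of the complex number [psi v], computed over the
reals so that only derivatives and limits of real functions occur. *)
Definition re_eval psi v : R := (map_mx (@complex.Re R) psi *m v) 0 0.
Definition im_eval psi v : R := (map_mx (@complex.Im R) psi *m v) 0 0.

Lemma map_Re_mulmx psi (M : 'M[R]_n) :
  map_mx (@complex.Re R) (psi *m map_mx (real_complex R) M)
  = map_mx (@complex.Re R) psi *m M.
Proof.
apply/rowP => j; rewrite !mxE raddf_sum; apply: eq_bigr => k _.
by rewrite !mxE; case: (psi 0 k) => x y; rewrite /= mulr0 subr0.
Qed.

Lemma map_Im_mulmx psi (M : 'M[R]_n) :
  map_mx (@complex.Im R) (psi *m map_mx (real_complex R) M)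
  = map_mx (@complex.Im R) psi *m M.
Proof.
apply/rowP => j; rewrite !mxE raddf_sum; apply: eq_bigr => k _.
by rewrite !mxE; case: (psi 0 k) => x y; rewrite /= mulr0 add0r.
Qed.

(** [psi M v = z (psi v) + phi v], split into real and imaginary parts here and in
the next lemma. *)
Lemma re_eval_step psi phi z (M : 'M[R]_n) v :
  psi *m map_mx (real_complex R) M = z *: psi + phi ->
  re_eval psi (M *m v)
  = complex.Re z * re_eval psi v - complex.Im z * im_eval psi v + re_eval phi v.
Proof.
move=> psiM; rewrite /re_eval mulmxA -map_Re_mulmx psiM.
have -> : map_mx (@complex.Re R) (z *: psi + phi)
    = complex.Re z *: map_mx (@complex.Re R) psi
      - complex.Im z *: map_mx (@complex.Im R) psi + map_mx (@complex.Re R) phi.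
  apply/rowP => j; rewrite !mxE raddfD; congr (_ + _).
  by case: z {psiM} => a b; case: (psi 0 j).
rewrite mulmxDl mulmxBl -!scalemxAl /im_eval.
move: (_ *m v) (_ *m v) (_ *m v) => x y u.
by rewrite !mxE.
Qed.

Lemma im_eval_step psi phi z (M : 'M[R]_n) v :
  psi *m map_mx (real_complex R) M = z *: psi + phi ->
  im_eval psi (M *m v)
  = complex.Im z * re_eval psi v + complex.Re z * im_eval psi v + im_eval phi v.
Proof.
move=> psiM; rewrite /im_eval mulmxA -map_Im_mulmx psiM.
have -> : map_mx (@complex.Im R) (z *: psi + phi)
    = complex.Im z *: map_mx (@complex.Re R) psi
      + complex.Re z *: map_mx (@complex.Im R) psi + map_mx (@complex.Im R) phi.
  apply/rowP => j; rewrite !mxE raddfD; congr (_ + _).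
  by case: z {psiM} => a b; case: (psi 0 j) => c d; rewrite /= addrC.
rewrite !mulmxDl -!scalemxAl /re_eval.
move: (_ *m v) (_ *m v) (_ *m v) => x y u.
by rewrite !mxE.
Qed.

Lemma re_eval0 v : re_eval 0 v = 0.
Proof. by rewrite /re_eval map_mx0 mul0mx mxE. Qed.

Lemma im_eval0 v : im_eval 0 v = 0.
Proof. by rewrite /im_eval map_mx0 mul0mx mxE. Qed.

Lemma is_derive_eval (U : 'rV[R]_n) (e : R -> 'cV[R]_n) (D : 'cV[R]_n) (t : R) :
  is_derive t 1 e D -> is_derive t 1 (fun s => (U *m e s) 0 0) ((U *m D) 0 0).
Proof. by move=> de; exact: (is_derive_mxP _ _ _).1 (is_derive_mulmx U de) 0 0. Qed.

Lemma cvg_eval (T : Type) (F : set_system T) (U : 'rV[R]_n) (e : T -> 'cV[R]_n)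
    (l : 'cV[R]_n) : Filter F ->
  e @ F --> l -> (U *m e x) 0 0 @[x --> F] --> (U *m l) 0 0.
Proof. move=> FF el; have UeUl : (U *m e x) @[x --> F] --> U *m l by exact: cvg_mulmx.
exact: (cvg_mxP _ _ _).1 UeUl 0 0. Qed.

End LinearFunctionals.

(** Peeling off the first factor turns [psi] into [phi = psi (M - z)], which is
killed by the remaining factors; [phi e] then tends to 0 by induction and is the
forcing term in the equation of [psi e].  No eigenvector is involved, so repeated
roots and Jordan blocks need no special care. *)
Lemma factor_decay (R : realType) (n : nat) (M : 'M[R]_n.+1) (e : R -> 'cV[R]_n.+1)
    (s : seq R[i]) (psi : 'rV[R[i]]_n.+1) :
  (forall t : R, 0 < t -> is_derive t 1 e (M *m e t)) ->
  (forall z, z \in s -> complex.Re z < 0) ->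
  psi *m (\prod_(z <- s) (map_mx (real_complex R) M - z%:M)) = 0 ->
  re_eval psi (e t) @[t --> +oo] --> 0 /\ im_eval psi (e t) @[t --> +oo] --> 0.
Proof.
move=> de; elim: s psi => [|z s IH] psi sneg.
  rewrite big_nil mulmx1 => ->.
  under eq_fun do rewrite re_eval0.
  under [X in _ /\ X @ _ --> _]eq_fun do rewrite im_eval0.
  by split; exact: cvg_cst.
rewrite big_cons => psi0.
pose phi := psi *m (map_mx (real_complex R) M - z%:M).
have psiM : psi *m map_mx (real_complex R) M = z *: psi + phi.
  by rewrite /phi mulmxBr mul_mx_scalar addrC subrK.
have [||re0 im0] := IH phi.
- by move=> y ys; apply: sneg; rewrite inE ys orbT.
- by rewrite -psi0 /phi -mulmxA.
apply: (@planar_decay _ (complex.Re z) (complex.Im z)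
  (fun t => re_eval psi (e t)) (fun t => im_eval psi (e t))
  (fun t => re_eval phi (e t)) (fun t => im_eval phi (e t)) _ _ _ re0 im0).
- by apply: sneg; rewrite mem_head.
- by move=> t t0; rewrite -(re_eval_step _ psiM); apply: is_derive_eval; exact: de.
- by move=> t t0; rewrite -(im_eval_step _ psiM); apply: is_derive_eval; exact: de.
Qed.

(** Every entry of [e] is some [psi e], and the characteristic polynomial of [M]
provides the product of factors that kills all [psi]. *)
Lemma hurwitz_decay (R : realType) (n : nat) (M : 'M[R]_n) (e : R -> 'cV[R]_n) :
  hurwitz M -> (forall t : R, 0 < t -> is_derive t 1 e (M *m e t)) ->
  e t @[t --> +oo] --> (0 : 'cV[R]_n).
Proof.
(* In dimension 0 there is no entry to consider; polynomials in a matrix need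
   a positive dimension. *)
case: n M e => [|n] M e hM de; apply/cvg_mxP => i j; first by case: i.
pose MC := map_mx (real_complex R) M.
have [s sE] := closed_field_poly_normal (char_poly MC).
rewrite (monicP (char_poly_monic _)) scale1r in sE.
have sneg z : z \in s -> complex.Re z < 0.
  move=> zs; apply: hM.
  by rewrite eigenvalue_root_char -/MC sE root_prod_XsubC.
have CH : \prod_(z <- s) (MC - z%:M) = 0.
  rewrite -[RHS](Cayley_Hamilton MC) sE rmorph_prod; apply: eq_bigr => z _.
  by rewrite rmorphB /= horner_mx_X horner_mx_C.
have [|+ _] := @factor_decay _ _ _ _ s (delta_mx 0 i) de sneg.
  by rewrite CH mulmx0.
rewrite (ord1 j) mxE; apply: cvg_trans; apply: near_eq_cvg; near=> t.
rewrite /re_eval (_ : map_mx _ _ = delta_mx 0 i) -?rowE ?mxE//.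
by apply/rowP => k; rewrite !mxE; case: (_ && _).
Unshelve. all: by end_near. Qed.

(** One decaying solution per initial value is enough: a left eigenvector [psi]
for an eigenvalue with nonnegative real part vanishes on the initial value of any
decaying solution, hence on every vector. *)
Lemma decay_hurwitz (R : realType) (n : nat) (M : 'M[R]_n) :
  (forall e0 : 'cV[R]_n, exists e : R -> 'cV[R]_n,
    [/\ e t @[t --> 0^'+] --> e0,
        forall t : R, 0 < t -> is_derive t 1 e (M *m e t)
      & e t @[t --> +oo] --> (0 : 'cV[R]_n)]) ->
  hurwitz M.
Proof.
move=> sol z /eigenvalueP[psi psiM psi_neq0]; rewrite ltNge; apply/negP => z0.
have psiM0 : psi *m map_mx (real_complex R) M = z *: psi + 0 by rewrite addr0.
have vanish e0 : re_eval psi e0 = 0 /\ im_eval psi e0 = 0.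
  have [e [ee0 de eoo]] := sol e0.
  apply: (planar_persistence (a := complex.Re z) (b := complex.Im z)
    (p := fun t => re_eval psi (e t)) (s := fun t => im_eval psi (e t))) => //.
  - move=> t t0; have <- : re_eval psi (M *m e t)
        = complex.Re z * re_eval psi (e t) - complex.Im z * im_eval psi (e t).
      by rewrite (re_eval_step _ psiM0) re_eval0 addr0.
    by apply: is_derive_eval; exact: de.
  - move=> t t0; have <- : im_eval psi (M *m e t)
        = complex.Im z * re_eval psi (e t) + complex.Re z * im_eval psi (e t).
      by rewrite (im_eval_step _ psiM0) im_eval0 addr0.
    by apply: is_derive_eval; exact: de.
  - exact: cvg_eval ee0.
  - exact: cvg_eval ee0.
  - rewrite -[0](_ : re_eval psi 0 = 0); last by rewrite /re_eval mulmx0 mxE.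
    exact: cvg_eval eoo.
  - rewrite -[0](_ : im_eval psi 0 = 0); last by rewrite /im_eval mulmx0 mxE.
    exact: cvg_eval eoo.
case/eqP: psi_neq0; apply/rowP => k; rewrite mxE.
have [] := vanish (delta_mx k 0); rewrite /re_eval /im_eval -!colE !mxE.
by case: (psi 0 k) => x y /= -> ->.
Qed.

(** * Solutions of the network *)

Section NetworkFlow.
Variables (R : realType) (n m q N : nat).
Variables (P : lti_system R n m q) (K : 'M[R]_(m, q)) (G : wdigraph R N).

(** Minus the transposed Laplacian of the graph.  It multiplies on the right
because the state of node [i] is stored as column [i]. *)
Let coupling : 'M[R]_N :=
  \matrix_(j, i) (weight G i j - (\sum_(k < N) weight G i k) * (j == i)%:R).

Let net_field : {linear 'M[R]_(n, N) -> 'M[R]_(n, N)} :=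
  mulmx (stateM P)
    \+ (mulmxr coupling \o mulmx (inputM P *m K *m outputM P)).

Let col_net_field (X : 'M[R]_(n, N)) i :
  col i (net_field X) =
    stateM P *m col i X + inputM P *m net_input P K G (fun j => col j X) i.
Proof.
have colM p r (U : 'M[R]_(p, r)) (V : 'M[R]_(r, N)) :
  col i (U *m V) = U *m col i V by rewrite !colE mulmxA.
rewrite /net_field /= raddfD /= !colM -!mulmxA; congr (_ + _ *m (_ *m _)).
have -> : X *m col i coupling
    = \sum_(j < N) weight G i j *: (col j X - col i X).
  transitivity (\sum_j weight G i j *: col j X
                - (\sum_j weight G i j) *: col i X); last first.
    rewrite scaler_suml -sumrB; apply: eq_bigr => j _.
    by rewrite scalerBr.
  apply/colP => k; rewrite !mxE summxE.
  have -> : (\sum_j weight G i j) * X k i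
      = \sum_j (\sum_j weight G i j) * (j == i)%:R * X k j.
    rewrite [RHS](bigD1 i)//= eqxx mulr1 [X in _ + X]big1 ?addr0// => j /negPf ->.
    by rewrite mulr0 mul0r.
  rewrite -sumrB; apply: eq_bigr => j _; rewrite !mxE.
  by rewrite mulrC mulrBl.
rewrite mulmx_sumr; apply: eq_bigr => j _.
by rewrite -scalemxAr mulmxBr.
Qed.

Lemma net_solution_exists (x0 : 'I_N -> 'cV[R]_n) :
  exists x, net_solution P K G x0 x.
Proof.
pose X0 : 'M[R]_(n, N) := \matrix_(k, i) x0 i k 0.
pose X t := linear_flow net_field X0 t.
have colX0 i : col i X0 = x0 i.
  by apply/colP => k; rewrite !mxE.
have dx i (t : R) : is_derive t 1 (fun s => col i (X s))
    (stateM P *m col i (X t) + inputM P *m net_input P K G (fun j => col j (X t)) i).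
  rewrite -col_net_field; apply/is_derive_mxP => k j; rewrite mxE.
  under eq_fun do rewrite mxE.
  exact: (is_derive_mxP _ _ _).1 (is_derive_linear_flow net_field X0 t) k i.
exists (fun i t => col i (X t)) => i; split.
- by rewrite /X linear_flow0 colX0.
- rewrite -[x0 i](_ : col i (X 0) = _); last by rewrite /X linear_flow0 colX0.
  apply: cvg_at_right_filter.
  have [dx0 _] := dx i 0.
  have : {for 0, continuous (fun s : R => col i (X s))}.
    exact/differentiable_continuous/derivable1_diffP.
  exact.
- by move=> t _; exact: dx.
Qed.

End NetworkFlow.

(** * The difference of the states of two nodes *)

Section Difference.
Variables (R : realType) (n m q : nat) (P : lti_system R n m q).

Lemma is_derive_difference (N : nat) (K : 'M[R]_(m, q)) (G : wdigraph R N)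
    (M : 'M[R]_n) (i k : 'I_N) x0 x :
  (forall y : 'I_N -> 'cV[R]_n,
     (stateM P *m y i + inputM P *m net_input P K G y i)
     - (stateM P *m y k + inputM P *m net_input P K G y k) = M *m (y i - y k)) ->
  net_solution P K G x0 x ->
  forall t : R, 0 < t ->
    is_derive t 1 (fun s => x i s - x k s) (M *m (x i t - x k t)).
Proof.
move=> fieldB sol t t0; rewrite -(fieldB (x^~ t)).
have [[_ _ di] [_ _ dk]] := (sol i, sol k).
have := di t t0; have := dk t t0 => dkt dit.
exact: is_deriveB.
Qed.

Fact uniform_weight_diag (N : nat) (i : 'I_N) :
  (\matrix_(j, k) ((j != k)%:R / N%:R) : 'M[R]_N) i i = 0.
Proof. by rewrite mxE eqxx mul0r. Qed.

Definition uniform_graph (N : nat) : wdigraph R N :=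
  WDigraph (@uniform_weight_diag N).

(** With weights [1/N], the input of node [i] is [K C (average - y i)]; the missing
loop at [i] would contribute [y i - y i] anyway.  The average is common to all
nodes and cancels in a difference. *)
Lemma uniform_graph_field (N : nat) (K : 'M[R]_(m, q)) (y : 'I_N -> 'cV[R]_n)
    (i k : 'I_N) :
  (stateM P *m y i + inputM P *m net_input P K (uniform_graph N) y i)
  - (stateM P *m y k + inputM P *m net_input P K (uniform_graph N) y k)
  = (stateM P - inputM P *m K *m outputM P) *m (y i - y k).
Proof.
have N0 : N%:R != 0 :> R by rewrite pnatr_eq0 -lt0n (leq_ltn_trans _ (ltn_ord i)).
have inputE j : net_input P K (uniform_graph N) y j
    = K *m outputM P *m (N%:R^-1 *: (\sum_l y l) - y j).
  rewrite /net_input -mulmxA; congr (_ *m _).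
  have -> : N%:R^-1 *: (\sum_l y l) - y j = \sum_l (N%:R^-1 *: (y l - y j)).
    rewrite -scaler_sumr sumrB scalerBr sumr_const card_ord -[y j *+ N]scaler_nat.
    by rewrite scalerA mulVf// scale1r.
  rewrite mulmx_sumr; apply: eq_bigr => l _.
  rewrite /net_output -mulmxBr -scalemxAr mxE.
  have [->|_] := eqVneq j l; first by rewrite subrr mulmx0 !scaler0.
  by rewrite mul1r.
rewrite !inputE !mulmxA opprD addrACA -!mulmxBr mulmxBl; congr (_ + _).
by rewrite opprB [_ - y i + _]addrC subrKA -[y k - y i]opprB mulmxN.
Qed.

(** Each of the two nodes moves towards the other in proportion to the weight of
its own edge, so their difference feels the sum of the two weights. *)
Lemma pair_field (K : 'M[R]_(m, q)) (G : wdigraph R 2) (y : 'I_2 -> 'cV[R]_n) :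
  (stateM P *m y 0 + inputM P *m net_input P K G y 0)
  - (stateM P *m y 1 + inputM P *m net_input P K G y 1)
  = (stateM P - inputM P *m ((weight G 0 1 + weight G 1 0) *: K) *m outputM P)
    *m (y 0 - y 1).
Proof.
have s01 (f : 'I_2 -> 'cV[R]_q) : \sum_(j < 2) f j = f 0 + f 1.
  rewrite 2!big_ord_recl big_ord0 addr0; congr (f _ + f _); exact: val_inj.
rewrite /net_input !s01 !subrr !scaler0 add0r addr0 /net_output -!mulmxBr.
rewrite opprD addrACA -mulmxBr mulmxBl; congr (_ + _).
rewrite -[y 1 - y 0]opprB !mulmxN scalerN !mulmxN -opprD; congr (- _).
by rewrite -!(scalemxAr, scalemxAl) -!mulmxA -scalerDl.
Qed.

End Difference.

Theorem proposition1 (R : realType) (n m q : nat)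
    (A : 'M[R]_n) (B : 'M[R]_(n, m)) (C : 'M[R]_(q, n)) :
  (forall N : nat, (1 < N)%N -> of_synchronizable (LTI A B C) N)
  <-> of_stabilizable (LTI A B C).
Proof.
split=> [/(_ 2 isT)[K [G sync]] | [K hK] N _].
- exists ((weight G 0 1 + weight G 1 0) *: K); apply: decay_hurwitz => e0.
  pose x0 (i : 'I_2) : 'cV[R]_n := if i == 0 then e0 else 0.
  have [x sol] := net_solution_exists (LTI A B C) K G x0.
  exists (fun t => x 0 t - x 1 t); split.
  + have [[_ c0 _] [_ c1 _]] := (sol 0, sol 1).
    by rewrite -[e0]subr0; exact: cvgB c0 c1.
  + exact: is_derive_difference (pair_field _ K G) sol.
  + exact: sync sol 0 1.
- exists K, (uniform_graph R N) => x0 x sol i j.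
  apply: (hurwitz_decay hK).
  exact: is_derive_difference (fun y => uniform_graph_field _ K y i j) sol.
Qed.
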